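(* Let $R$ be an integral domain. The injective objects in the category $\mathbf{Sp}_R$ are precisely the Specker $R$-algebras that are Baer rings.
   Context: All algebras are commutative and unital and all algebra homomorphisms are unital. For a commutative $R$-algebra $S$, $\mathrm{Id}(S)$ is the set of idempotents of $S$, a Boolean algebra under $e\vee f=e+f-ef$, $e\wedge f=ef$, $\lnot e=1-e$. A nonzero idempotent $e\in S$ is faithful if for each $a\in R$, $ae=0$ implies $a=0$. A faithful generating algebra of idempotents of $S$ is a Boolean subalgebra $B$ of $\mathrm{Id}(S)$ that generates $S$ as an $R$-algebra and all of whose nonzero elements are faithful. $S$ is a Specker $R$-algebra if it is a commutative $R$-algebra that has a faithful generating algebra of idempotents. $\mathbf{Sp}_R$ is the category of Specker $R$-algebras and $R$-algebra homomorphisms. Injectivity is in the usual categorical sense (with respect to monomorphisms of $\mathbf{Sp}_R$). A commutative ring is a Baer ring if the annihilator ideal of each of its subsets is a principal ideal generated by an idempotent. *)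

(* Defs.v *)
From mathcomp Require Import all_boot all_algebra.
From mathcomp Require Import classical_sets.

Set Implicit Arguments.
Unset Strict Implicit.
Unset Printing Implicit Defensive.

Import GRing.Theory.
Local Open Scope classical_set_scope.
Local Open Scope ring_scope.

(* Commutative unital R-algebras, given by a unital ring morphism R -> S.
   The library's [comAlgType R] is not used because it requires 1 != 0, which
   would exclude the zero algebra; the latter is a Specker algebra (its algebra
   of idempotents is {0}, and the condition on nonzero elements is vacuous). *)
Record commAlgebra (R : comPzRingType) := CommAlgebra {
  alg_carrier :> comPzRingType;
  alg_map : {rmorphism R -> alg_carrier}
}.

Definition alg_scale (R : comPzRingType) (S : commAlgebra R) (a : R) (x : S)
  : S := alg_map S a * x.

Record algHom (R : comPzRingType) (A B : commAlgebra R) := AlgHom {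
  hom_fun :> {rmorphism A -> B};
  hom_scale : forall (a : R) (x : A),
    hom_fun (alg_scale a x) = alg_scale a (hom_fun x)
}.

Section Idempotents.
Variable S : comPzRingType.

Definition Id : set S := [set e | e * e = e].

Definition idem_join (e f : S) : S := e + f - e * f.
Definition idem_meet (e f : S) : S := e * f.
Definition idem_compl (e : S) : S := 1 - e.

Definition boolean_subalgebra (B : set S) : Prop :=
  [/\ B `<=` Id, B 0 /\ B 1,
      forall e f, B e -> B f -> B (idem_join e f),
      forall e f, B e -> B f -> B (idem_meet e f)
    & forall e, B e -> B (idem_compl e)].

End Idempotents.

Section Specker.
Variables (R : comPzRingType) (S : commAlgebra R).

Definition is_subalgebra (A : set S) : Prop :=
  GRing.subring_closed [in A] /\
  forall (a : R) (x : S), A x -> A (alg_scale a x).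

Definition subalgebra_generated (B : set S) : set S := smallest is_subalgebra B.

Definition faithful (e : S) : Prop :=
  [/\ Id e, e <> 0 & forall a : R, alg_scale a e = 0 -> a = 0].

Definition faithful_generating_algebra (B : set S) : Prop :=
  [/\ boolean_subalgebra B,
      subalgebra_generated B = [set: S]
    & forall e, B e -> e <> 0 -> faithful e].

Definition is_specker : Prop :=
  exists B : set S, faithful_generating_algebra B.

End Specker.

(* The category Sp_R: objects are [speckerAlgebra R], morphisms are [algHom],
   and equality of morphisms is pointwise equality [=1]. *)
Record speckerAlgebra (R : comPzRingType) := SpeckerAlgebra {
  specker_alg :> commAlgebra R;
  specker_algP : is_specker specker_alg
}.

Definition sp_mono (R : comPzRingType) (A B : speckerAlgebra R)
    (f : algHom A B) : Prop :=
  forall (T : speckerAlgebra R) (g h : algHom T A),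
    f \o g =1 f \o h -> g =1 h.

Definition sp_injective (R : comPzRingType) (E : speckerAlgebra R) : Prop :=
  forall (A B : speckerAlgebra R) (f : algHom A B), sp_mono f ->
  forall g : algHom A E, exists h : algHom B E, h \o f =1 g.

Section Baer.
Variable S : comPzRingType.

Definition annihilator (X : set S) : set S :=
  [set y | forall x, X x -> y * x = 0].

Definition principal_ideal (e : S) : set S := range (fun y : S => y * e).

Definition baer_ring : Prop :=
  forall X : set S, exists2 e, Id e & annihilator X = principal_ideal e.

End Baer.

(* Main.v *)
Require Import Defs.
From HB Require Import structures.
From mathcomp Require Import all_boot all_algebra.
From mathcomp Require Import boolp classical_sets ring.

Set Implicit Arguments.
Unset Strict Implicit.
Unset Printing Implicit Defensive.

Import GRing.Theory.
Local Open Scope classical_set_scope.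
Local Open Scope ring_scope.

(** A Specker algebra over a domain is torsion-free and reduced, because each of
    its elements is locally a scalar: for some idempotents e_1, ..., e_n with sum
    1, the products x e_i are scalar multiples of e_i. This makes monomorphisms
    injective. If S is a Baer ring, a homomorphism into S extends along an
    injection A -> B by Zorn's lemma: an idempotent b of B can always be added to
    the domain of a partial homomorphism, its image being forced only up to an
    interval of idempotents, and annihilators in S provide an element of it.
    Conversely, for a subset X of an injective S, the annihilators of X and of
    Ann X meet in 0, so S embeds in S / Ann(Ann X) * S / Ann X. There the
    idempotent (1, 0) annihilates X and fixes Ann X, and a retraction onto S maps
    it to an idempotent of S that generates Ann X. *)

(** * Quotients of commutative rings *)

Record ringIdeal (A : comPzRingType) := RingIdeal {
  ideal_zmod :> zmodClosed A;
  idealM : forall a x : A, x \in ideal_zmod -> a * x \in ideal_zmod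
}.

(* The library's [{ideal_quot I}] requires a proper ideal of a nontrivial ring;
   zero rings have to be allowed here. *)
Section Quotient.
Local Open Scope quotient_scope.
Variables (A : comPzRingType) (I : ringIdeal A).

Definition quotient_ring := Quotient.quot I.
HB.instance Definition _ := GRing.Zmodule.on quotient_ring.
HB.instance Definition _ := @EqQuotient.on quotient_ring.

Definition quotient_one : quotient_ring := \pi_quotient_ring 1.
Definition quotient_mul (x y : quotient_ring) : quotient_ring :=
  \pi_quotient_ring (repr x * repr y).

Lemma quotient_piP (x y : A) :
  (\pi_quotient_ring x = \pi_quotient_ring y) <-> x - y \in I.
Proof. by rewrite Quotient.idealrBE; split=> /eqP. Qed.

Lemma quotient_piM : {morph \pi_quotient_ring : x y / x * y >-> quotient_mul x y}.
Proof.
move=> x y; apply/quotient_piP.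
have rK z : z - repr (\pi_quotient_ring z) \in I by apply/quotient_piP; rewrite reprK.
set rx := repr (\pi x); set ry := repr (\pi y).
have -> : x * y - rx * ry = x * (y - ry) + ry * (x - rx).
  by rewrite !mulrBr ![ry * _]mulrC addrA subrK.
by apply: rpredD; exact/idealM/rK.
Qed.

Lemma quotient_mulA : associative quotient_mul.
Proof.
move=> x y z; rewrite -[x]reprK -[y]reprK -[z]reprK.
move: (repr x) (repr y) (repr z) => a b c.
rewrite -(quotient_piM b c) -(quotient_piM a b).
by rewrite -(quotient_piM a) -(quotient_piM (a * b)) mulrA.
Qed.

Lemma quotient_mulC : commutative quotient_mul.
Proof.
move=> x y; rewrite -[x]reprK -[y]reprK.
by rewrite -(quotient_piM (repr x)) -(quotient_piM (repr y)) mulrC.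
Qed.

Lemma quotient_mul1 : left_id quotient_one quotient_mul.
Proof. by move=> x; rewrite -[x]reprK -(quotient_piM 1) mul1r. Qed.

Lemma quotient_piD : {morph \pi_quotient_ring : x y / x + y >-> x + y}.
Proof. by move=> x y; exact: (raddfD (\pi_(Quotient.quot I))). Qed.

Lemma quotient_mulDl : left_distributive quotient_mul +%R.
Proof.
move=> x y z; rewrite -[x]reprK -[y]reprK -[z]reprK.
move: (repr x) (repr y) (repr z) => a b c.
rewrite -quotient_piD -(quotient_piM (a + b)) -(quotient_piM a).
by rewrite -(quotient_piM b) -quotient_piD mulrDl.
Qed.

HB.instance Definition _ := GRing.Zmodule_isComPzRing.Build quotient_ring
  quotient_mulA quotient_mulC quotient_mul1 quotient_mulDl.

Definition quotient_proj (x : A) : quotient_ring := \pi_quotient_ring x.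

Lemma quotient_proj_is_zmod_morphism : zmod_morphism quotient_proj.
Proof. by move=> x y; exact: (raddfB (\pi_(Quotient.quot I))). Qed.

Lemma quotient_proj_is_monoid_morphism : monoid_morphism quotient_proj.
Proof. by split=> // x y; exact: quotient_piM. Qed.

HB.instance Definition _ := GRing.isZmodMorphism.Build A quotient_ring
  quotient_proj quotient_proj_is_zmod_morphism.
HB.instance Definition _ := GRing.isMonoidMorphism.Build A quotient_ring
  quotient_proj quotient_proj_is_monoid_morphism.

Lemma quotient_proj_surj (q : quotient_ring) : exists x, quotient_proj x = q.
Proof. by exists (repr q); exact: reprK. Qed.

Lemma quotient_proj_eq0 (x : A) : quotient_proj x = 0 <-> x \in I.
Proof.
by rewrite -[X in _ = X](rmorph0 quotient_proj) -[X in X \in I]subr0; exact: quotient_piP.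
Qed.

End Quotient.

(** Interface to the quotient: later arguments use only the surjectivity and the kernel of [p]. *)
Lemma ex_quotient (A : comPzRingType) (I : set A) :
    I 0 -> (forall x y, I x -> I y -> I (x - y)) ->
    (forall a x, I x -> I (a * x)) ->
  exists (Q : comPzRingType) (p : {rmorphism A -> Q}),
    (forall q, exists x, p x = q) /\ (forall x, p x = 0 <-> I x).
Proof.
move=> I0 IB IM.
have clI : zmod_closed [in I].
  by split=> [|x y]; rewrite !inE //; exact: IB.
pose J := HB.pack_for (zmodClosed A) (fun x => x \in I)
  (GRing.isZmodClosed.Build A _ clI).
have JM (a x : A) : x \in J -> a * x \in J by rewrite !inE; exact: IM.
exists (quotient_ring (RingIdeal JM)), (@quotient_proj A (RingIdeal JM)).
split=> [q|x]; first exact: quotient_proj_surj.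
by rewrite quotient_proj_eq0 inE.
Qed.

(** * Extending partial homomorphisms into Baer rings *)

Section PartialHom.
Variables B E : comPzRingType.

(* The graph of a ring homomorphism from a subring of [B] to [E]. *)
Definition partial_hom (G : set (B * E)) : Prop :=
  [/\ G 1, forall p q, G p -> G q -> G (p - q),
      forall p q, G p -> G q -> G (p * q) & forall s, G (0, s) -> s = 0].

(* [b] is sent to the idempotent [s] generating the annihilator of the image of
   the elements killed by [b]: this [s] kills that image, and it fixes the image
   of every [y] with [y = y * b], since such a [y] kills the elements killed by
   [b]. The new domain is [D * b + D * (1 - b)], for [D] the old one. *)
Lemma partial_hom_adjoin (G : set (B * E)) (b : B) :
    baer_ring E -> Id b -> partial_hom G ->
  exists G', [/\ partial_hom G', G `<=` G' & exists s, G' (b, s)].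
Proof.
move=> baerE bb [G1 GB GM Gf].
have G0 : G 0 by rewrite -(subrr 1); exact: GB.
have [s ss annE] := baerE [set u | exists2 x, G (x, u) & x * b = 0].
have s_kill x u : G (x, u) -> x * b = 0 -> u * s = 0.
  move=> Gxu xb0; rewrite mulrC.
  have : principal_ideal s s by exists 1; rewrite // mul1r.
  by rewrite -annE; apply; exists x.
have s_fix y v : G (y, v) -> y * (1 - b) = 0 -> v * (1 - s) = 0.
  move=> Gyv yb.
  have yE : y = y * b by apply/eqP; rewrite -subr_eq0 -{1}[y]mulr1 -mulrBr yb.
  have : annihilator [set u | exists2 x, G (x, u) & x * b = 0] v.
    move=> u [x Gxu xb0]; apply: Gf; have := GM _ _ Gyv Gxu.
    suff -> : (y, v) * (x, u) = (0, v * u) by [].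
    by congr (_, _); rewrite /= yE -mulrA [b * x]mulrC xb0 mulr0.
  by rewrite annE => -[w _ <-]; rewrite mulrBr mulr1 -mulrA ss subrr.
pose c : B * E := (b, s).
have cc : c * c = c by rewrite /c; congr (_, _).
have c1c : c * (1 - c) = 0 by rewrite mulrBr mulr1 cc subrr.
have c1c1 : (1 - c) * (1 - c) = 1 - c by rewrite mulrBl mul1r c1c subr0.
(* As [c] is idempotent, multiplication acts separately on the coefficients of [c] and of
   [1 - c]. *)
exists [set p | exists u v, [/\ G u, G v & p = u * c + v * (1 - c)]].
split; last first.
- by exists s, 1, 0; split=> //; rewrite mul1r mul0r addr0.
- by move=> u Gu; exists u, u; split=> //; rewrite -mulrDr addrC subrK mulr1.
split.
- by exists 1, 1; split=> //; rewrite -mulrDr addrC subrK mulr1.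
- move=> _ _ [u [v [Gu Gv ->]]] [u' [v' [Gu' Gv' ->]]].
  by exists (u - u'), (v - v'); split; [exact: GB|exact: GB|];
    rewrite !mulrBl opprD addrACA.
- move=> _ _ [u [v [Gu Gv ->]]] [u' [v' [Gu' Gv' ->]]].
  exists (u * u'), (v * v'); split; [exact: GM|exact: GM|].
  have -> : (u * c + v * (1 - c)) * (u' * c + v' * (1 - c)) =
      u * u' * (c * c) + v * v' * ((1 - c) * (1 - c))
      + (u * v' + v * u') * (c * (1 - c)) by ring.
  by rewrite cc c1c c1c1 mulr0 addr0.
(* Multiplying the first coordinate by [b] gives [x * b = 0], hence [y * (1 - b) = 0]; then [s_kill]
   and [s_fix] annihilate both terms of [t]. *)
move=> t [[x u] [[y v] [Gu Gv /= E1]]].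
have [Ex Et] : 0 = x * b + y * (1 - b) /\ t = u * s + v * (1 - s) by case: E1.
have b1b : b * (1 - b) = 0 by rewrite mulrBr mulr1 bb subrr.
have xb : x * b = 0.
  have /(congr1 ( *%R^~ b)) := Ex.
  by rewrite mul0r mulrDl -!mulrA bb [(1 - b) * b]mulrC b1b mulr0 addr0.
have yb : y * (1 - b) = 0 by rewrite {1}Ex xb add0r.
by rewrite Et (s_kill _ _ Gu xb) (s_fix _ _ Gv yb) addr0.
Qed.

(* Zorn's lemma is applied to the sets [G] such that [G0 `|` G] is a partial
   homomorphism, so that the empty chain needs no special treatment. *)
Lemma partial_hom_maximal (G0 : set (B * E)) : partial_hom G0 ->
  exists M, [/\ partial_hom M, G0 `<=` M
    & forall G, partial_hom G -> M `<=` G -> G `<=` M].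
Proof.
move=> hG0.
have [F Fhom Ftot|M [hM maxM]] := @Zorn_bigcup _ (fun G => partial_hom (G0 `|` G)).
  set U := \bigcup_(X in F) X.
  (* By totality of the chain, two elements always lie in a single partial homomorphism, where the
     closure conditions can be checked. *)
  have common p q : (G0 `|` U) p -> (G0 `|` U) q ->
      exists Z, [/\ partial_hom Z, Z `<=` G0 `|` U, Z p & Z q].
    have sU X : F X -> G0 `|` X `<=` G0 `|` U.
      by move=> FX z [|Xz]; [left|right; exists X].
    case=> [pG0|[X FX Xp]] [qG0|[Y FY Yq]].
    - by exists G0; split=> // z; left.
    - by exists (G0 `|` Y); split; [exact: Fhom|exact: sU|left|right].
    - by exists (G0 `|` X); split; [exact: Fhom|exact: sU|right|left].
    have [XY|YX] := Ftot X Y FX FY.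
      by exists (G0 `|` Y); split; [exact: Fhom|exact: sU|right; exact: XY|right].
    by exists (G0 `|` X); split; [exact: Fhom|exact: sU|right|right; exact: YX].
  split.
  - by left; case: hG0.
  - move=> p q Up Uq; have [Z [[_ ZB _ _] + Zp Zq]] := common p q Up Uq.
    by apply; exact: ZB.
  - move=> p q Up Uq; have [Z [[_ _ ZM _] + Zp Zq]] := common p q Up Uq.
    by apply; exact: ZM.
  - move=> s Us; have [Z [[_ _ _ Zf] _ Zs _]] := common _ _ Us Us.
    exact: Zf.
exists (G0 `|` M); split=> // G hG MG.
apply: contrapT => GM; apply: (maxM G).
  split; first by move=> z Mz; apply: MG; right.
  by move=> GsM; apply: GM => z /GsM; right.
suff -> : G0 `|` G = G by [].
by apply/seteqP; split=> z; [case=> // G0z; apply: MG; left|right].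
Qed.

End PartialHom.

(** * Specker algebras *)

Section Diagonal.
Variable T : comPzRingType.

Definition diagonal (x : T) : T * T := (x, x).

Lemma diagonal_is_zmod_morphism : zmod_morphism diagonal.
Proof. by []. Qed.

Lemma diagonal_is_monoid_morphism : monoid_morphism diagonal.
Proof. by []. Qed.

HB.instance Definition _ := GRing.isZmodMorphism.Build T (T * T)%type
  diagonal diagonal_is_zmod_morphism.
HB.instance Definition _ := GRing.isMonoidMorphism.Build T (T * T)%type
  diagonal diagonal_is_monoid_morphism.

(** Only differences and products occur, to fit the induction principle [subalgebra_generatedT]. *)
Lemma pairE (x y : T) :
  (x, y) = diagonal x * (1, 0) - (0 - diagonal y * (0, 1)).
Proof.
by congr (_, _); rewrite /= !(mulr1, mulr0, sub0r, opprK, addr0, add0r, oppr0).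
Qed.

Lemma Id_pair10 : Id ((1, 0) : T * T).
Proof. by congr (_, _); rewrite /= ?mulr1 ?mulr0. Qed.

Lemma Id_pair01 : Id ((0, 1) : T * T).
Proof. by congr (_, _); rewrite /= ?mulr1 ?mulr0. Qed.

End Diagonal.

Lemma Id_rmorph (T U : comPzRingType) (f : {rmorphism T -> U}) (e : T) :
  Id e -> Id (f e).
Proof. by rewrite /Id /= -rmorphM => ->. Qed.

Section Algebra.
Variable R : comPzRingType.
Implicit Types A B E S : commAlgebra R.

Lemma hom_alg_map A B (f : algHom A B) a : f (alg_map A a) = alg_map B a.
Proof. by have := hom_scale f a 1; rewrite /alg_scale rmorph1 !mulr1. Qed.

Lemma alg_map_hom_scale A B (f : {rmorphism A -> B}) :
    (forall a, f (alg_map A a) = alg_map B a) ->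
  forall a x, f (alg_scale a x) = alg_scale a (f x).
Proof. by move=> fa a x; rewrite /alg_scale rmorphM fa. Qed.

(** Generation as an induction principle; scaling is multiplication by some [alg_map S a], so
    containing these replaces closure under scaling. *)
Lemma subalgebra_generatedT S (X : set S) :
  subalgebra_generated X = setT <->
  forall P : set S, X `<=` P -> (forall a, P (alg_map S a)) ->
    (forall x y, P x -> P y -> P (x - y)) ->
    (forall x y, P x -> P y -> P (x * y)) -> forall x, P x.
Proof.
split=> [genX P XP Pa PB PM x|ind].
  have : subalgebra_generated X x by rewrite genX.
  apply; split=> //; split; last by move=> a y; exact: PM.
  split=> [|y z|y z]; rewrite !inE.
  - by rewrite -(rmorph1 (alg_map S)).
  - exact: PB.
  - exact: PM.
apply/seteqP; split=> // x _; apply: ind x => [x Xx|a|x y xX yX|x y xX yX] P [Psub XP].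
- exact: XP.
- case: Psub => -[P1 _ _] PZ; rewrite -[alg_map S a]mulr1; apply: PZ.
  by rewrite inE in P1.
- case: (Psub) => -[_ PB _] _.
  by have := PB x y; rewrite !inE; apply; [exact: xX|exact: yX].
- case: (Psub) => -[_ _ PM] _.
  by have := PM x y; rewrite !inE; apply; [exact: xX|exact: yX].
Qed.

Definition torsion_free S : Prop :=
  forall (a : R) (x : S), alg_scale a x = 0 -> a = 0 \/ x = 0.

Lemma idem_compl_id (T : comPzRingType) (e : T) : Id e -> Id (1 - e).
Proof.
by rewrite /Id /= => ee; rewrite mulrBr mulr1 mulrBl mul1r ee subrr subr0.
Qed.

(** Torsion-freeness makes every nonzero idempotent faithful, so the algebra of all idempotents is a
    witness. *)
Lemma specker_torsion_free_Id S :
  torsion_free S -> subalgebra_generated (@Id S) = setT -> is_specker S.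
Proof.
move=> tfS genS; exists (@Id S); split=> // [|e ee e0]; last first.
  by split=> // a /tfS[].
have meet (e f : S) : Id e -> Id f -> Id (e * f).
  by rewrite /Id /= => ee ff; rewrite mulrACA ee ff.
split=> //.
- by split; rewrite /Id /= ?mulr0 ?mulr1.
- move=> e f ee ff; rewrite /idem_join.
  have -> : e + f - e * f = 1 - (1 - e) * (1 - f) by ring.
  by apply: idem_compl_id; apply: meet; exact: idem_compl_id.
- exact: idem_compl_id.
Qed.

Lemma specker_generated_Id S : is_specker S -> subalgebra_generated (@Id S) = setT.
Proof.
move=> [X [[XId _ _ _ _] genX _]]; apply/subalgebra_generatedT => P IdP.
by apply: ((subalgebra_generatedT X).1 genX) => x /XId /IdP.
Qed.

Lemma baer_hom_extension A B E (f : algHom A B) (g : algHom A E) :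
    subalgebra_generated (@Id B) = setT -> baer_ring E -> injective f ->
  exists h : algHom B E, h \o f =1 g.
Proof.
move=> genB baerE injf.
(* The graph of [g] after the inverse of [f], single-valued because [f] is injective. *)
pose G0 : set (B * E) := [set p | exists x, p = (f x, g x)].
have hG0 : partial_hom G0.
  split.
  - by exists 1; rewrite !rmorph1.
  - by move=> _ _ [x ->] [y ->]; exists (x - y); rewrite !rmorphB.
  - by move=> _ _ [x ->] [y ->]; exists (x * y); rewrite !rmorphM.
  - move=> s [x [fx0 ->]]; suff -> : x = 0 by rewrite rmorph0.
    by apply: injf; rewrite rmorph0.
have [M [hM G0M maxM]] := partial_hom_maximal hG0.
case: (hM) => M1 MB MM Mf.
(* The domain of [M] is a subring containing the scalars and, by maximality, all idempotents. *)
have domM b : exists s, M (b, s).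
  apply: ((subalgebra_generatedT (@Id B)).1 genB (fun b => exists s, M (b, s))) b.
  - move=> b bb; have [G [hG MG [s Gs]]] := partial_hom_adjoin baerE bb hM.
    by exists s; exact: maxM hG MG _ Gs.
  - move=> a; exists (alg_map E a); apply: G0M; exists (alg_map A a).
    by rewrite !hom_alg_map.
  - by move=> x y [s Ms] [t Mt]; exists (s - t); exact: MB _ _ Ms Mt.
  - by move=> x y [s Ms] [t Mt]; exists (s * t); exact: MM _ _ Ms Mt.
have [h Mh] := choice domM.
(* Two values at [b] differ by a value at 0, which vanishes. *)
have Muniq b s : M (b, s) -> h b = s.
  move=> Ms; apply/eqP; rewrite -subr_eq0; apply/eqP; apply: Mf.
  by rewrite -(subrr b); exact: MB _ _ (Mh b) Ms.
have hB : zmod_morphism h by move=> x y; apply: Muniq; exact: MB _ _ (Mh x) (Mh y).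
have hM' : monoid_morphism h.
  by split=> [|x y]; apply: Muniq; [exact: M1|exact: MM _ _ (Mh x) (Mh y)].
pose H : {rmorphism B -> E} := HB.pack h (GRing.isZmodMorphism.Build B E h hB)
  (GRing.isMonoidMorphism.Build B E h hM').
have hfg x : H (f x) = g x by apply: Muniq; apply: G0M; exists x.
have Ha a : H (alg_map B a) = alg_map E a by rewrite -(hom_alg_map f) hfg hom_alg_map.
by exists (AlgHom (alg_map_hom_scale Ha)).
Qed.

End Algebra.

(** * Specker algebras over an integral domain *)

Section IntegralDomain.
Variable R : idomainType.
Implicit Types A B E S : commAlgebra R.

Definition has_partition S (X : set S) (x : S) : Prop :=
  exists es : seq S, \sum_(e <- es) e = 1 /\
    forall e, e \in es -> X e /\ exists a : R, x * e = alg_scale a e.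

Lemma specker_partition S (X : set S) : faithful_generating_algebra X ->
  forall x : S, has_partition X x.
Proof.
move=> [[XId [X0 X1] _ XM XC] genX _].
(* Common refinement: the products [e * f] again sum to 1, and on each of them both [x] and [y] are
   scalars. *)
have refine (op : S -> S -> S) (opR : R -> R -> R) :
    (forall x y e f a b, x * e = alg_scale a e -> y * f = alg_scale b f ->
      op x y * (e * f) = alg_scale (opR a b) (e * f)) ->
    forall x y, has_partition X x -> has_partition X y ->
      has_partition X (op x y).
  move=> opP x y [es [es1 esP]] [fs [fs1 fsP]].
  exists [seq e * f | e <- es, f <- fs]; split.
    rewrite big_allpairs_dep /= -[RHS]es1; apply: eq_bigr => e _.
    by rewrite -mulr_sumr fs1 mulr1.
  move=> _ /allpairsP[[e f] /= [/esP[Xe [a xe]] /fsP[Xf [b yf]] ->]].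
  by split; [exact: XM|exists (opR a b); exact: opP].
apply: ((subalgebra_generatedT X).1 genX) => [x Xx|a||].
- have xx : x * x = x by exact: XId.
  exists [:: x; 1 - x]; split; first by rewrite !big_cons big_nil addr0 addrC subrK.
  move=> e; rewrite !inE => /orP[] /eqP ->.
    by split=> //; exists 1; rewrite /alg_scale rmorph1 xx mul1r.
  split; first exact: XC.
  by exists 0; rewrite /alg_scale rmorph0 mul0r mulrBr mulr1 xx subrr.
- exists [:: 1]; split=> [|e]; first by rewrite big_seq1.
  by rewrite inE => /eqP ->; split=> //; exists a.
- apply: (refine _ (fun a b => a - b)) => x y e f a b xe yf.
  rewrite /alg_scale in xe yf *.
  rewrite rmorphB !mulrBl mulrA xe; congr (_ - _); first by rewrite mulrA.
  by rewrite mulrCA yf mulrCA.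
- apply: (refine _ *%R) => x y e f a b xe yf.
  by rewrite mulrACA xe yf /alg_scale rmorphM mulrACA.
Qed.

(** As [x] is the sum of the [x * e] over a partition, some [x * e] is nonzero, which forces [a] and
    [e] to be nonzero. *)
Lemma specker_neq0 S (X : set S) (x : S) : faithful_generating_algebra X -> x <> 0 ->
  exists (a : R) (e : S), [/\ a <> 0, e <> 0, X e & x * e = alg_scale a e].
Proof.
move=> hX x0; have [es [es1 esP]] := specker_partition hX x.
have [e ees xe0] : exists2 e, e \in es & x * e <> 0.
  apply: contrapT => nex; apply: x0.
  rewrite -[x]mulr1 -es1 mulr_sumr big_seq big1 // => e ees.
  by apply: contrapT => xe0; apply: nex; exists e.
have [Xe [a xe]] := esP e ees; exists a, e; split=> // [a0|e0]; apply: xe0.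
  by rewrite xe a0 /alg_scale rmorph0 mul0r.
by rewrite e0 mulr0.
Qed.

(** If [x * e] is the nonzero multiple of [e] by [a], then [c * a] kills the faithful [e], so
    [c * a = 0] in the domain [R]. *)
Lemma specker_torsion_free S : is_specker S -> torsion_free S.
Proof.
move=> [X hX] c x cx0; have [x0|x0] := pselect (x = 0); first by right.
left; have [a [e [a0 e0 Xe xe]]] := specker_neq0 hX x0.
have [_ _ Xfaith] := hX; have [_ _ efaith] := Xfaith e Xe e0.
have : c * a = 0.
  apply: efaith; rewrite /alg_scale rmorphM -mulrA -[_ * e]xe.
  by rewrite mulrA [_ * x]cx0 mul0r.
by move/eqP; rewrite mulf_eq0 => /orP[/eqP //|/eqP].
Qed.

Lemma specker_reduced S : is_specker S -> forall x : S, x * x = 0 -> x = 0.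
Proof.
move=> spS x xx0; apply: contrapT => x0.
have [X hX] := spS; have [a [e [a0 e0 Xe xe]]] := specker_neq0 hX x0.
have : alg_scale (a * a) e = 0.
  rewrite /alg_scale rmorphM -mulrA -[_ * e]xe mulrCA.
  by rewrite -[_ * e]xe mulrA xx0 mul0r.
move=> /(specker_torsion_free spS)[/eqP|//].
by rewrite mulf_eq0 orbb => /eqP.
Qed.

(** The free Specker algebra on one idempotent, namely [(1, 0)]. *)
Definition domain_square : commAlgebra R := CommAlgebra (@diagonal R).

Lemma domain_square_specker : is_specker domain_square.
Proof.
apply: specker_torsion_free_Id => [a [x y] [ax0 ay0]|].
  have [->|a0] := eqVneq a 0; [by left|right].
  by congr (_, _); apply: (mulfI a0); rewrite mulr0.
apply/subalgebra_generatedT => P IdP Pa PB PM [x y].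
have P10 : P (1, 0) by apply: IdP; exact: Id_pair10.
have P01 : P (0, 1) by apply: IdP; exact: Id_pair01.
have P0 : P 0 by rewrite -(subrr (1, 0)); exact: PB.
rewrite pairE; apply: (PB _ _ (PM _ _ (Pa x) P10)).
by apply: (PB _ _ P0); exact: PM _ _ (Pa y) P01.
Qed.

Lemma domain_square_hom A (e : A) : Id e ->
  exists g : algHom domain_square A,
    forall a b, g (a, b) = alg_map A a * e + alg_map A b * (1 - e).
Proof.
move=> ee; rewrite /Id /= in ee.
pose g (p : domain_square) : A := alg_map A p.1 * e + alg_map A p.2 * (1 - e).
have gB : zmod_morphism g.
  by move=> [a b] [c d]; rewrite /g /= !rmorphB; ring.
have gM : monoid_morphism g.
  split=> [|[a b] [c d]]; rewrite /g /= ?rmorph1 ?rmorphM; first by ring.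
  set a' := alg_map A a; set b' := alg_map A b.
  set c' := alg_map A c; set d' := alg_map A d.
  (* The product is the expected value up to a multiple of [e * e - e]. *)
  have -> : (a' * e + b' * (1 - e)) * (c' * e + d' * (1 - e)) =
    a' * c' * e + b' * d' * (1 - e)
    + (a' * c' + b' * d' - a' * d' - b' * c') * (e * e - e) by ring.
  by rewrite ee subrr mulr0 addr0.
pose G : {rmorphism domain_square -> A} :=
  HB.pack g (GRing.isZmodMorphism.Build domain_square A g gB)
    (GRing.isMonoidMorphism.Build domain_square A g gM).
have Ga a : G (alg_map domain_square a) = alg_map A a.
  by rewrite /= /g /=; ring.
by exists (AlgHom (alg_map_hom_scale Ga)).
Qed.

(* An idempotent [e] with [f e = 0] gives two maps from [R * R], sending [(1, 0)]
   to [e] and to [0], that [f] equalizes. The general case reduces to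
   idempotents, as any [x <> 0] has a multiple [x e = a e] with [a], [e <> 0]. *)
Lemma sp_mono_injective (A B : speckerAlgebra R) (f : algHom A B) :
  sp_mono f -> injective f.
Proof.
move=> monof.
have idem0 (e : A) : Id e -> f e = 0 -> e = 0.
  move=> ee fe0.
  have [g gE] := domain_square_hom ee.
  have [h hE] : exists h : algHom domain_square A,
      forall a b, h (a, b) = alg_map A a * 0 + alg_map A b * (1 - 0).
    by apply: domain_square_hom; rewrite /Id /= mulr0.
  have fgh : f \o g =1 f \o h.
    by move=> [a b]; rewrite /= gE hE !rmorphD !rmorphM !rmorphB fe0 rmorph0.
  have := monof (SpeckerAlgebra domain_square_specker) g h fgh (1, 0).
  by rewrite gE hE !rmorph0 rmorph1 !mul0r !mul1r !addr0.
suff ker0 x : f x = 0 -> x = 0.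
  move=> x y fxy; apply/eqP; rewrite -subr_eq0; apply/eqP; apply: ker0.
  by rewrite rmorphB fxy subrr.
move=> fx0; apply: contrapT => x0.
have [X hX] := specker_algP A; have [[XId _ _ _ _] _ _] := hX.
have [a [e [a0 e0 Xe xe]]] := specker_neq0 hX x0.
have : alg_scale a (f e) = 0 by rewrite -hom_scale -xe rmorphM fx0 mul0r.
case/(specker_torsion_free (specker_algP B)) => // fe0.
by apply: e0; apply: idem0 => //; exact: XId.
Qed.

(* The quotient [Q] of [S * S] built here is S / Ann(Ann X) * S / Ann X. *)
Lemma sp_injective_baer (S : speckerAlgebra R) : sp_injective S -> baer_ring S.
Proof.
move=> injS X.
have tfS := specker_torsion_free (specker_algP S).
pose I : set (S * S) :=
  [set p | annihilator (annihilator X) p.1 /\ annihilator X p.2].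
have ann0 (Y : set S) : annihilator Y 0 by move=> y _; rewrite mul0r.
have annB (Y : set S) x y :
    annihilator Y x -> annihilator Y y -> annihilator Y (x - y).
  by move=> Yx Yy z Yz; rewrite mulrBl Yx // Yy // subrr.
have annM (Y : set S) a x : annihilator Y x -> annihilator Y (a * x).
  by move=> Yx z Yz; rewrite -mulrA Yx // mulr0.
(* Nonzero scalars can be cancelled in annihilators; this makes the quotient torsion-free. *)
have ann_sat (Y : set S) (c : R) x :
    c <> 0 -> annihilator Y (alg_map S c * x) -> annihilator Y x.
  by move=> c0 Ycx z Yz; have := Ycx z Yz; rewrite -mulrA => /tfS[].
have [||a x [? ?]|Q [p [psurj pker]]] := @ex_quotient _ I.
- by split; exact: ann0.
- by move=> x y [? ?] [? ?]; split; exact: annB.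
- by split; exact: annM.
have p_eq u v : I (u - v) -> p u = p v.
  by move=> /pker/eqP; rewrite rmorphB subr_eq0 => /eqP.
pose C := CommAlgebra (p \o @diagonal S \o alg_map S : {rmorphism R -> Q}).
have spC : is_specker C.
  apply: specker_torsion_free_Id => [c q|].
    have [[x y] <-] := psurj q; rewrite /alg_scale /= -rmorphM => /pker[/= Icx Icy].
    have [->|/eqP c0] := eqVneq c 0; [by left|right].
    by apply/pker; split; [exact: ann_sat c0 Icx|exact: ann_sat c0 Icy].
  apply/subalgebra_generatedT => P IdP Pa PB PM q.
  (* The quotient is generated by the diagonal image of [S], itself generated by idempotents,
     together with the images of [(1, 0)] and [(0, 1)]. *)
  have Pdiag (s : S) : P (p (s, s)).
    apply: ((subalgebra_generatedT _).1 (specker_generated_Id (specker_algP S))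
      (fun s => P (p (s, s)))) s.
    - move=> e ee; apply: IdP; apply: Id_rmorph.
      exact: (Id_rmorph (@diagonal S) ee).
    - exact: Pa.
    - by move=> x y Px Py; have := PB _ _ Px Py; rewrite -rmorphB.
    - by move=> x y Px Py; have := PM _ _ Px Py; rewrite -rmorphM.
  have P10 : P (p (1, 0)) by apply: IdP; apply: Id_rmorph; exact: Id_pair10.
  have P01 : P (p (0, 1)) by apply: IdP; apply: Id_rmorph; exact: Id_pair01.
  have P0 : P 0 by rewrite -(subrr (p (1, 0))); exact: PB.
  have [[x y] <-] := psurj q.
  rewrite pairE !rmorphB !rmorphM rmorph0.
  apply: (PB _ _ (PM _ _ (Pdiag x) P10)).
  by apply: (PB _ _ P0); exact: PM _ _ (Pdiag y) P01.
have fa a : (p \o @diagonal S) (alg_map S a) = alg_map C a by [].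
pose f : algHom S C := AlgHom (alg_map_hom_scale
  (f := (p \o @diagonal S : {rmorphism S -> C})) fa).
(* The difference [x - y] lies in Ann X and in Ann(Ann X), so its square is 0. *)
have injf : injective f.
  move=> x y /eqP; rewrite -subr_eq0 -rmorphB => /eqP/pker[/= I1 I2].
  apply/eqP; rewrite -subr_eq0; apply/eqP.
  by apply: (specker_reduced (specker_algP S)); exact: I1.
have idS a x : idfun (alg_scale a x) = alg_scale a (idfun x) :> S by [].
(* Extending the identity of [S] along [f] gives the retraction [h]. *)
have [|h hf] := injS S (SpeckerAlgebra spC) f _ (AlgHom (hom_fun := idfun) idS).
  by move=> T g1 g2 fg x; apply: injf; exact: fg.
have hp s : h (p (s, s)) = s by exact: hf s.
exists (h (p (1, 0))).
  by do 2!apply: Id_rmorph; exact: Id_pair10.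
have hpM s : s * h (p (1, 0)) = h (p (s, 0)).
  by rewrite -{1}(hp s) -!rmorphM; congr (h (p (_, _))); rewrite /= ?mulr1 ?mulr0.
(* For [y] in Ann X, [(y, 0)] and [(y, y)] have the same class, so the idempotent fixes [y]. For [x]
   in [X], [x] lies in Ann(Ann X), so [(x, 0)] has class 0 and the idempotent kills [x]. *)
apply/seteqP; split=> [y Xy|_ [z _ <-] x Xx].
  exists y => //; rewrite hpM -[RHS]hp; congr (h _); apply: p_eq; split=> /=.
    by rewrite subrr; exact: ann0.
  by apply: annB => //; exact: ann0.
rewrite -mulrA [_ * x]mulrC hpM.
suff -> : p (x, 0) = 0 by rewrite rmorph0 mulr0.
apply/pker; split=> /= [w Xw|]; last exact: ann0.
by rewrite mulrC; exact: Xw.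
Qed.

End IntegralDomain.

Theorem corollary4p8 (R : idomainType) (S : speckerAlgebra R) :
  sp_injective S <-> baer_ring S.
Proof.
split=> [|baerS A B f monof g]; first exact: sp_injective_baer.
apply: baer_hom_extension => //; last exact: sp_mono_injective.
exact: specker_generated_Id (specker_algP B).
Qed.
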